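(* Let $\Gamma=(X,R)$ be a bipartite distance-regular graph with even diameter $D\ge4$ and valency $k\ge3$, let $d=D/2$, fix $x\in X$, let $W$ be a thin irreducible $T(x)$-module with endpoint $2$ and local eigenvalue $\tilde\theta_d$, and let $v$ be a nonzero vector in $E^*_2W$. With respect to the basis $E^*_{i+2}A_iv$ $(0\le i\le D-3)$ of $W$ (in this order), the matrix representing $A$ is the $(D-2)\times(D-2)$ tridiagonal matrix with all diagonal entries $0$, subdiagonal entries $c_1,c_2,\dots,c_{D-3}$ and superdiagonal entries $\omega_1,\omega_2,\dots,\omega_{D-3}$, where $$\omega_i=\frac{b_{i+1}c_{i+2}}{c_i}\,\frac{P_{i-1}(0)P_{i+2}(0)}{P_i(0)P_{i+1}(0)}\qquad(1\le i\le D-3).$$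
   Context: $\Gamma$ is a finite connected bipartite distance-regular graph with distance $\partial$, intersection numbers $c_i,b_i$; $A_i$ distance matrices, $A=A_1$, eigenvalues $\theta_0>\dots>\theta_D$. $E^*_i$ is diagonal with $(y,y)$-entry $1$ if $\partial(x,y)=i$, else $0$; $T(x)$ is generated by $A,E^*_0,\dots,E^*_D$; thin: $\dim E^*_iW\le1$ for all $i$; endpoint $\min\{i:E^*_iW\ne0\}$; local eigenvalue of a thin irreducible $W$ with endpoint $2$: the eigenvalue of $E^*_2A_2E^*_2$ on $E^*_2W$. $\tilde\theta_d=-1-b_2b_3(\theta_d^2-b_2)^{-1}$. Polynomials: $f_0=1,f_{-1}=0$, $\lambda f_i=b_{i-1}f_{i-1}+c_{i+1}f_{i+1}$; $p_i=f_i+f_{i-2}+\cdots$ (ending in $f_0$ or $f_1$ according to parity); $p_i(\lambda)=P_i(\lambda^2)$ for $i$ even, $p_i(\lambda)=\lambda P_i(\lambda^2)$ for $i$ odd; $P_{-1}=0$. *)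

(* Defs.v *)
From mathcomp Require Import all_boot all_order all_algebra.

Set Implicit Arguments.
Unset Strict Implicit.
Unset Printing Implicit Defensive.

Import Order.TTheory GRing.Theory Num.Theory.
Local Open Scope ring_scope.

Section Graph.
Variables (X : finType) (e : rel X).

Definition simple_graph : Prop := symmetric e /\ irreflexive e.

Definition connected_graph : Prop := forall x y, connect e x y.

Definition bipartite : Prop :=
  exists side : X -> bool, forall x y, e x y -> side x != side y.

Definition regular (k : nat) : Prop := forall x, #|[set y | e x y]| = k.

Definition walk (n : nat) (x y : X) : bool :=
  [exists s : n.-tuple X, path e x s && (last x s == y)].

(* Least length of a walk from x to y. In a connected graph this is < #|X|;
   the value is #|X| when there is no walk at all. *)
Definition dist (x y : X) : nat := find (fun n => walk n x y) (iota 0 #|X|).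

Definition diameter : nat := \max_(x : X) \max_(y : X) dist x y.

(* p h i j is the intersection number p^h_{ij}. Its values for h larger than
   the diameter are unconstrained. *)
Definition distance_regular (p : nat -> nat -> nat -> nat) : Prop :=
  forall (i j : nat) (x y : X),
    #|[set z | (dist x z == i) && (dist z y == j)]| = p (dist x y) i j.

End Graph.

Definition cnum (p : nat -> nat -> nat -> nat) (i : nat) : nat := p i 1%N i.-1.
Definition bnum (p : nat -> nat -> nat -> nat) (i : nat) : nat := p i 1%N i.+1.

Section TerwilligerAlgebra.
Variables (C : numClosedFieldType) (X : finType) (e : rel X).

(* Matrices and vectors indexed by X are indexed by 'I_#|X| via enum_val. *)
Local Notation Mat := 'M[C]_#|X|.
Local Notation Vec := 'cV[C]_#|X|.

Definition dist_mx (i : nat) : Mat :=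
  \matrix_(a, b) (dist e (enum_val a) (enum_val b) == i)%:R.

Definition Estar (x : X) (i : nat) : Mat :=
  diag_mx (\row_a (dist e x (enum_val a) == i)%:R).

(* theta j for j > D is unconstrained. *)
Definition ordered_eigenvalues (D : nat) (theta : nat -> C) : Prop :=
  (forall i j : nat, (i < j <= D)%N -> theta j < theta i) /\
  (forall a : C, eigenvalue (dist_mx 1) a <->
                 exists2 i : nat, (i <= D)%N & theta i = a).

(* Membership in T(x). Estar x i is 0 for i beyond the diameter. *)
Inductive in_T (x : X) : Mat -> Prop :=
| in_T_adj : in_T x (dist_mx 1)
| in_T_Estar i : in_T x (Estar x i)
| in_T_one : in_T x 1%:M
| in_T_add B1 B2 : in_T x B1 -> in_T x B2 -> in_T x (B1 + B2)
| in_T_scale a B : in_T x B -> in_T x (a *: B)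
| in_T_mul B1 B2 : in_T x B1 -> in_T x B2 -> in_T x (B1 *m B2).

Definition T_module (x : X) (W : {vspace Vec}) : Prop :=
  forall B : Mat, in_T x B -> forall w : Vec, w \in W -> B *m w \in W.

Definition T_irreducible (x : X) (W : {vspace Vec}) : Prop :=
  [/\ T_module x W, W != 0%VS &
      forall U : {vspace Vec}, T_module x U -> (U <= W)%VS ->
        U = 0%VS \/ U = W].

Definition mxim (B : Mat) (W : {vspace Vec}) : {vspace Vec} :=
  (linfun (mulmx B) @: W)%VS.

Definition thin (x : X) (W : {vspace Vec}) : Prop :=
  forall i : nat, (\dim (mxim (Estar x i) W) <= 1)%N.

Definition has_endpoint (x : X) (W : {vspace Vec}) (r : nat) : Prop :=
  mxim (Estar x r) W != 0%VS /\
  forall i : nat, (i < r)%N -> mxim (Estar x i) W = 0%VS.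

(* Meaningful when W is thin of endpoint 2, so that the space E*_2 W is a
   line. *)
Definition has_local_eigenvalue (x : X) (W : {vspace Vec}) (eta : C) : Prop :=
  forall w : Vec, w \in mxim (Estar x 2) W ->
    (Estar x 2 *m dist_mx 2 *m Estar x 2) *m w = eta *: w.

(* The columns of B hold the coordinates of the images of the basis vectors. *)
Definition represents (m : nat) (w : m.-tuple Vec) (A : Mat) (B : 'M[C]_m) :
  Prop := forall j : 'I_m, A *m tnth w j = \sum_(i < m) B i j *: tnth w i.

End TerwilligerAlgebra.

Section Polynomials.
Variables (C : numClosedFieldType) (p : nat -> nat -> nat -> nat).

Local Notation c i := ((cnum p i)%:R : C).
Local Notation b i := ((bnum p i)%:R : C).

(* The solution of 'X * f_i = b_{i-1} f_{i-1} + c_{i+1} f_{i+1} with f_0 = 1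
   and f_{-1} = 0. *)
Fixpoint fpoly (n : nat) : {poly C} :=
  match n with
  | 0 => 1
  | n1.+1 =>
    match n1 with
    | 0 => (c 1)^-1 *: 'X
    | n2.+1 => (c n)^-1 *: ('X * fpoly n1 - b n2 *: fpoly n2)
    end
  end.

Definition ppoly (i : nat) : {poly C} :=
  \sum_(j < i.+1 | odd j == odd i) fpoly j.

Definition Ppoly (i : nat) : {poly C} :=
  if odd i then odd_poly (ppoly i) else even_poly (ppoly i).

Lemma fpoly0 : fpoly 0 = 1. Proof. by []. Qed.

Lemma fpoly_rec0 : c 1 != 0 -> 'X * fpoly 0 = c 1 *: fpoly 1.
Proof. by move=> c0; rewrite /= scalerA divff // scale1r mulr1. Qed.

Lemma fpoly_rec i : c i.+2 != 0 ->
  'X * fpoly i.+1 = b i *: fpoly i + c i.+2 *: fpoly i.+2.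
Proof.
move=> c0; rewrite [fpoly i.+2]/= scalerA divff // scale1r.
by rewrite addrC subrK.
Qed.

Lemma coef_fpoly_parity n j : odd j != odd n -> (fpoly n)`_j = 0.
Proof.
suff H : forall n, (forall j, odd j != odd n -> (fpoly n)`_j = 0) /\
                   (forall j, odd j != odd n.+1 -> (fpoly n.+1)`_j = 0).
  by move=> h; case: (H n) => + _; apply.
elim=> [|m [IH0 IH1]]; split=> //.
- by move=> [|i] //= h; rewrite coef1.
- by move=> [|[|i]] //= h; rewrite coefZ coefX ?mulr0.
move=> i h; rewrite [fpoly m.+2]/= coefZ coefB coefZ coefXM.
rewrite (IH0 i) ?mulr0 ?subr0; last by move: h; rewrite /= negbK.
case: i h => [|i] h /=; first by rewrite mulr0.
by rewrite IH1 ?mulr0 //; move: h => /=; do 2!case: odd.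
Qed.

Lemma coef_ppoly_parity n j : odd j != odd n -> (ppoly n)`_j = 0.
Proof.
move=> h; rewrite coef_sum big1 // => i /eqP hi.
by rewrite coef_fpoly_parity // hi.
Qed.

(* The defining property of P_i. *)
Lemma ppolyE i :
  ppoly i = (if odd i then 'X else 1) * (Ppoly i \Po 'X^2).
Proof.
rewrite -[LHS]poly_even_odd /Ppoly; case: ifP => oi.
  suff -> : even_poly (ppoly i) = 0 by rewrite comp_poly0 add0r mulrC.
  apply/polyP => j; rewrite coef_even_poly coef0 coef_ppoly_parity //.
  by rewrite odd_double oi.
suff -> : odd_poly (ppoly i) = 0 by rewrite comp_poly0 mul0r addr0 mul1r.
apply/polyP => j; rewrite coef_odd_poly coef0 coef_ppoly_parity //.
by rewrite /= odd_double oi.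
Qed.

Definition omega (i : nat) : C :=
  b i.+1 * c i.+2 / c i *
  (((Ppoly i.-1).[0] * (Ppoly i.+2).[0]) / ((Ppoly i).[0] * (Ppoly i.+1).[0])).

(* Row and column indices start at 0: entry (j+1, j) is c_{j+1} and entry
   (j, j+1) is omega_{j+1}. *)
Definition tridiag (m : nat) : 'M[C]_m :=
  \matrix_(i, j)
    if i == j.+1 :> nat then c i
    else if j == i.+1 :> nat then omega j
    else 0.

End Polynomials.

(* Main.v *)
Require Import Defs.
From mathcomp Require Import all_boot all_order all_algebra.
From mathcomp Require Import ring zify.

(* The spectrum of a bipartite graph is symmetric about 0, so theta_d = 0 and
   the local eigenvalue is b_3 - 1.  Put w_n = E*_{n+2} A_n v,
   u_n = E*_n A_n v, z_n = E*_{n-2} A_n v.  Since E*_0 W = 0, the entries of v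
   sum to zero, whence w_n + u_{n+2} + z_{n+4} = 0.  Projecting
   A A_n v = b_{n-1} A_{n-1} v + c_{n+1} A_{n+1} v onto the spheres around x
   gives
     E*_{n+3} A w_n = c_{n+1} w_{n+1},
     E*_{n+2} A w_{n+1} + E*_{n+2} A u_{n+1} = b_n w_n + c_{n+2} u_{n+2},
     E*_{n+2} A z_{n+5} = b_{n+4} z_{n+4}.
   Thinness gives u_{n+2} = alpha_{n+2} w_n, and these relations determine the
   scalars alpha_n recursively, starting from the local eigenvalue alpha_2;
   they are solved in closed form by the numbers P_i(0), which are nonzero for
   i < D by a sign argument.  As P_D(0) = 0, A annihilates w_{D-2}, which must
   vanish because W is irreducible. *)

Set Implicit Arguments.
Unset Strict Implicit.
Unset Printing Implicit Defensive.

Import Order.TTheory GRing.Theory Num.Theory.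
Local Open Scope ring_scope.

(** * Distance in a bipartite graph *)

Section Distance.
Variables (X : finType) (e : rel X).

Lemma walkP n x y :
  reflect (exists s : seq X, [/\ size s = n, path e x s & last x s = y])
          (walk e n x y).
Proof.
apply: (iffP existsP) => [[s /andP[ps /eqP ls]]|[s [ss ps ls]]].
  by exists s; rewrite size_tuple.
have h : size s == n by rewrite ss.
by exists (Tuple h); rewrite /= ps ls eqxx.
Qed.

Lemma walk_cat m n x y z :
  walk e m x y -> walk e n y z -> walk e (m + n) x z.
Proof.
move=> /walkP[s [<- ps ls]] /walkP[t [<- pt lt]].
by apply/walkP; exists (s ++ t); rewrite size_cat cat_path last_cat ls ps pt.
Qed.

Lemma walk0 x y : walk e 0 x y = (x == y).
Proof.
apply/walkP/eqP => [[s [/size0nil-> _ /= ->]] //|->].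
by exists [::].
Qed.

Lemma walk1 x y : e x y -> walk e 1 x y.
Proof. by move=> exy; apply/walkP; exists [:: y]; rewrite /= exy. Qed.

Lemma walkS n x y : walk e n.+1 x y -> exists2 z, e x z & walk e n z y.
Proof.
case/walkP=> -[|z s] [] //= [ss] /andP[exz ps] ls.
by exists z => //; apply/walkP; exists s.
Qed.

Lemma walk_sym n x y : symmetric e -> walk e n x y -> walk e n y x.
Proof.
move=> esym; elim: n x => [|n IH] x; first by rewrite !walk0 eq_sym.
case/walkS=> z exz /IH wyz.
by rewrite -addn1; apply: walk_cat wyz (walk1 _); rewrite esym.
Qed.

Lemma dist_le n x y : walk e n x y -> (dist e x y <= n)%N.
Proof.
(* For n at least [#|X|] the bound holds because [find] never exceeds the length of the list it
   searches. *)
move=> w; rewrite /dist; case: (ltnP n #|X|) => hn; last first.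
  by apply: leq_trans hn; rewrite -{2}(size_iota 0 #|X|) find_size.
rewrite leqNgt; apply/negP => /(before_find 0%N).
by rewrite nth_iota // add0n w.
Qed.

Hypothesis conn : connected_graph e.

(** A shortened path repeats no vertex, so it has fewer than [#|X|] edges and the bounded search in
    [dist] succeeds. *)
Lemma walk_dist x y : walk e (dist e x y) x y.
Proof.
have [s ps ls] := connectP (conn x y).
case/shortenP: ps ls => t pt ut _ lt.
have st : (size t < #|X|)%N.
  by have := max_card (mem (x :: t)); rewrite (card_uniqP ut).
have hs : has (fun n => walk e n x y) (iota 0 #|X|).
  apply/hasP; exists (size t); first by rewrite mem_iota.
  by apply/walkP; exists t.
have := nth_find 0%N hs; rewrite nth_iota ?add0n //.
by rewrite has_find size_iota in hs.
Qed.

Lemma dist_triangle y x z : (dist e x z <= dist e x y + dist e y z)%N.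
Proof. by apply: dist_le; apply: walk_cat; exact: walk_dist. Qed.

Lemma dist_eq0 x y : (dist e x y == 0)%N = (x == y).
Proof.
apply/idP/idP => [/eqP d0|/eqP->].
  by have := walk_dist x y; rewrite d0 walk0.
by rewrite -leqn0 dist_le // walk0.
Qed.

Lemma dist_step n x y : dist e x y = n.+1 ->
  exists2 z, e x z & dist e z y = n.
Proof.
move=> dxy; have := walk_dist x y; rewrite dxy => /walkS[z exz wzy].
exists z => //; apply/eqP; rewrite eqn_leq dist_le //=.
have := dist_triangle z x y; rewrite dxy => h.
have d1 : (dist e x z <= 1)%N by rewrite dist_le // walk1.
by have := leq_trans h (leq_add d1 (leqnn _)); rewrite add1n ltnS.
Qed.

Lemma dist_le_diameter x y : (dist e x y <= diameter e)%N.
Proof.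
apply: leq_trans (leq_bigmax x).
exact: (leq_bigmax (F := fun y => dist e x y) y).
Qed.

(** Distances drop by one along a geodesic between vertices at maximal distance. Such pairs give
    access to the numbers [p h i j]. *)
Lemma dist_attained (x0 : X) h :
  (h <= diameter e)%N -> exists x y, dist e x y = h.
Proof.
have X0 : (0 < #|X|)%N by apply/card_gt0P; exists x0.
have [x Dx] := @bigop.eq_bigmax X (fun x => \max_(y : X) dist e x y) X0.
have [y Dy] := @bigop.eq_bigmax X (fun y => dist e x y) X0.
have {Dx Dy}Dxy : dist e x y = diameter e by rewrite /diameter Dx Dy.
rewrite -Dxy => {Dxy}; move Dn : (dist e x y) => n.
elim: n x Dn => [|n IH] z Dn.
  by rewrite leqn0 => /eqP->; exists z, y.
rewrite leq_eqVlt => /orP[/eqP->|]; first by exists z, y.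
by have [t _ /IH] := dist_step Dn.
Qed.

Hypothesis esimple : simple_graph e.

Lemma dist_sym x y : dist e x y = dist e y x.
Proof.
have [esym _] := esimple.
by apply/eqP; rewrite eqn_leq !dist_le // walk_sym // walk_dist.
Qed.

Lemma dist_eq1 x y : (dist e x y == 1)%N = e x y.
Proof.
have [_ eirr] := esimple.
apply/idP/idP => [/eqP d1|exy].
  by have := walk_dist x y; rewrite d1 => /walkS[z exz];
    rewrite walk0 => /eqP<-.
rewrite eqn_leq dist_le ?walk1 // lt0n dist_eq0.
by apply: contraTneq exy => ->; rewrite eirr.
Qed.

Hypothesis bip : bipartite e.

(** Each edge changes colour, so the parity of a distance is the colour difference of its ends. *)
Lemma dist_parity x y z :
  odd (dist e x z) = odd (dist e x y) (+) odd (dist e y z).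
Proof.
have [side hs] := bip.
suff H s t : odd (dist e s t) = side s (+) side t.
  by rewrite !H addbA addbK.
elim: {s}_.+1 {-2}s (ltnSn (dist e s t)) => // n IH s; rewrite ltnS => hn.
case Dst: (dist e s t) => [|m].
  by move/eqP: Dst; rewrite dist_eq0 => /eqP->; rewrite addbb.
have [r esr Dr] := dist_step Dst.
have := IH r; rewrite Dr Dst /= in hn * => ->; last by rewrite hn.
by have := hs _ _ esr; do 2!case: (side _) => //=; case: (side _).
Qed.

(** The triangle inequality bounds the difference by one; parity excludes equality. *)
Lemma dist_adj x y z : dist e y z = 1%N ->
  dist e x y = (dist e x z).+1 \/ dist e x z = (dist e x y).+1.
Proof.
move=> dyz.
have h1 := dist_triangle z x y; have h2 := dist_triangle y x z.
have hp := dist_parity x y z; rewrite (dist_sym z y) dyz addn1 in h1 h2 *.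
move: h1 h2 hp; rewrite dyz.
rewrite leq_eqVlt => /orP[/eqP->|]; first by left.
rewrite ltnS addn1 => h1; rewrite leq_eqVlt => /orP[/eqP->|]; first by right.
rewrite ltnS => h2; have -> : dist e x y = dist e x z.
  by apply/eqP; rewrite eqn_leq h1 h2.
by case: (odd _).
Qed.

End Distance.

(** * Intersection numbers and distance matrices *)

Section IntersectionNumbers.
Variables (X : finType) (e : rel X) (p : nat -> nat -> nat -> nat).
Hypotheses (esimple : simple_graph e) (conn : connected_graph e).
Hypotheses (bip : bipartite e) (dr : distance_regular e p).
Variable x0 : X.

(** Since [0.-1] is 0, [cnum p 0] counts the vertices at distance both 1 and 0 from [x0]. *)
Lemma cnum0 : cnum p 0 = 0%N.
Proof.
rewrite /cnum /=; have /eqP d0 : dist e x0 x0 == 0%N by rewrite dist_eq0.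
rewrite -{1}d0 -dr; apply: eq_card0 => z; rewrite !inE.
by apply/negP => /andP[/eqP h]; rewrite dist_sym // h.
Qed.

Lemma cnum1 : (1 <= diameter e)%N -> cnum p 1 = 1%N.
Proof.
move=> /(dist_attained conn x0)[x [y dxy]].
rewrite /cnum /= -{1}dxy -dr; apply/eqP/cards1P; exists y.
apply/setP => z; rewrite !inE dist_eq0 //.
by case: (z =P y) => [->|]; rewrite ?andbF // dxy.
Qed.

Lemma cnum_gt0 i : (i < diameter e)%N -> (0 < cnum p i.+1)%N.
Proof.
move=> /(dist_attained conn x0)[x [y dxy]].
rewrite /cnum /= -dxy -dr; have [z exz dz] := dist_step conn dxy.
apply/card_gt0P; exists z; rewrite !inE dz eqxx andbT.
by rewrite dist_eq1.
Qed.

Lemma bnum_gt0 i : (i < diameter e)%N -> (0 < bnum p i)%N.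
Proof.
move=> /(dist_attained conn x0)[x [y dxy]].
have [z exz dz] := dist_step conn dxy.
rewrite /bnum -{1}dz -dr; apply/card_gt0P; exists x.
by rewrite !inE dxy eqxx andbT dist_eq1 //; case: esimple => ->.
Qed.

Lemma bnum_diameter : bnum p (diameter e) = 0%N.
Proof.
have [x [y dxy]] := dist_attained conn x0 (leqnn (diameter e)).
rewrite /bnum -{1}dxy -dr; apply: eq_card0 => z; rewrite !inE.
apply/negP => /andP[_ /eqP h].
by have := dist_le_diameter e z y; rewrite h ltnn.
Qed.

(** Each neighbour of x is one step nearer to y or one step farther; bipartiteness excludes equal
    distance. *)
Lemma bnum_cnum k i : regular e k -> (i <= diameter e)%N ->
  (bnum p i + cnum p i)%N = k.
Proof.
move=> reg /(dist_attained conn x0)[x [y dxy]].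
rewrite -(reg x) /bnum /cnum -{1 3}dxy -!dr -cardsUI [X in (_ + X)%N]eq_card0.
  rewrite addn0; apply: eq_card => z; rewrite !inE -(dist_eq1 conn esimple).
  case: eqP => //= dxz; have [] := dist_adj conn esimple bip y dxz.
    rewrite !(dist_sym conn esimple y) dxy => ->.
    by rewrite eqxx orbT.
  by rewrite !(dist_sym conn esimple y) dxy => ->; rewrite eqxx.
move=> z; rewrite !inE; apply/negP => /andP[/andP[_ /eqP->] /andP[_]].
by rewrite gtn_eqF // ltnS leq_pred.
Qed.

(** * Distance matrices and dual idempotents *)

Variable C : numClosedFieldType.
Local Notation A i := (dist_mx C e i).
Local Notation Es i := (Estar C e x0 i).

Lemma adj_dist_mx i a b :
  (A 1 *m A i) a b = (p (dist e (enum_val a) (enum_val b)) 1 i)%:R.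
Proof.
rewrite mxE -dr -sum1_card natr_sum.
rewrite [RHS](reindex (fun c : 'I_#|X| => enum_val c)) /=; last first.
  by apply: onW_bij; exact: enum_val_bij.
rewrite [RHS]big_mkcond; apply: eq_bigr => c _; rewrite !mxE inE.
by do 2!case: eqP => _ /=; rewrite ?mulr0 ?mul0r ?mulr1.
Qed.

Lemma dist_mx0 : A 0 = 1%:M.
Proof.
by apply/matrixP => a b; rewrite !mxE dist_eq0 // (inj_eq enum_val_inj).
Qed.

Lemma p_adj_eq0 h x y i : dist e x y = h -> i != h.+1 -> h != i.+1 ->
  p h 1 i = 0%N.
Proof.
move=> <- h1 h2; rewrite -dr; apply: eq_card0 => z; rewrite !inE.
apply/negP => /andP[/eqP dxz /eqP dzy].
have [] := dist_adj conn esimple bip y dxz;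
  rewrite !(dist_sym conn esimple y) dzy.
  by move=> dE; rewrite dE eqxx in h2.
by move=> dE; rewrite dE eqxx in h1.
Qed.

(** Bipartiteness removes the diagonal term. Every i is allowed: a coefficient whose distance does
    not occur multiplies a zero matrix. *)
Lemma dist_mx_rec i : A 1 *m A i.+1 =
  (bnum p i)%:R *: A i + (cnum p i.+2)%:R *: A i.+2.
Proof.
apply/matrixP => a b; rewrite adj_dist_mx !mxE /bnum /cnum /=.
move Dh: (dist e _ _) => h.
case: (h =P i) => [->|/eqP hi].
  by rewrite ltn_eqF ?leqnSn // mulr1 mulr0 addr0.
case: (h =P i.+2) => [->|/eqP hi2]; first by rewrite mulr1 mulr0 add0r.
have hi' : i.+1 != h.+1 by rewrite eqSS eq_sym.
by rewrite (p_adj_eq0 Dh hi' hi2) !mulr0 addr0.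
Qed.

Lemma Estar_mulE i n (M : 'M[C]_(#|X|, n)) a b :
  (Es i *m M) a b = (dist e x0 (enum_val a) == i)%:R * M a b.
Proof. by rewrite mul_diag_mx !mxE. Qed.

Lemma mul_EstarE i n (M : 'M[C]_(n, #|X|)) a b :
  (M *m Es i) a b = M a b * (dist e x0 (enum_val b) == i)%:R.
Proof. by rewrite mul_mx_diag !mxE. Qed.

Lemma Estar_idem i : Es i *m Es i = Es i.
Proof.
rewrite /Estar mulmx_diag; congr diag_mx; apply/rowP => a; rewrite !mxE.
by case: eqP => _; rewrite ?mul0r ?mul1r.
Qed.

Lemma Estar_orth i j : i != j -> Es i *m Es j = 0.
Proof.
move=> ij; apply/matrixP => a b; rewrite Estar_mulE !mxE.
case: (a == b) => /=; last by rewrite mulr0n mulr0.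
case: eqP => [di|_]; last by rewrite mul0r.
by rewrite di (negPf ij) mulr0n mulr0.
Qed.

(* A bipartite graph has no edge inside a sphere around x0. *)
Lemma Estar_adj j : Es j.+1 *m A 1 =
  Es j.+1 *m A 1 *m Es j + Es j.+1 *m A 1 *m Es j.+2.
Proof.
apply/matrixP => a b; rewrite [RHS]mxE !mul_EstarE !Estar_mulE !mxE.
case: eqP => [da|]; last by rewrite !mul0r addr0.
case: (dist e (enum_val a) _ =P 1%N) => [d1|]; last first.
  by rewrite !mulr0 !mul0r addr0.
have [] := dist_adj conn esimple bip x0 d1; rewrite da.
  by case=> <-; rewrite eqxx ltn_eqF // !(mulr1,mulr0,addr0).
by move=> ->; rewrite eqxx gtn_eqF // !(mulr1,mulr0,add0r).
Qed.

Lemma adj_Estar j : A 1 *m Es j.+1 =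
  Es j *m A 1 *m Es j.+1 + Es j.+2 *m A 1 *m Es j.+1.
Proof.
apply/matrixP => a b; rewrite [RHS]mxE !mul_EstarE !Estar_mulE !mxE.
case: (dist e x0 (enum_val b) =P _) => [db|]; last by rewrite !mulr0 addr0.
case: (dist e (enum_val a) _ =P 1%N) => [d1|]; last first.
  by rewrite !mulr0 !mul0r addr0.
have [] := dist_adj conn esimple bip x0 d1; rewrite db.
  by move=> ->; rewrite eqxx gtn_eqF // !(mulr1,mulr0,add0r).
by case=> <-; rewrite eqxx ltn_eqF // !(mulr1,mulr0,addr0).
Qed.

Lemma Estar_dist_mx_eq0 i j n :
  (i + n < j)%N || (j + n < i)%N || (i + j < n)%N ->
  Es i *m A n *m Es j = 0.
Proof.
move=> H; apply/matrixP => a b; rewrite mul_EstarE Estar_mulE !mxE.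
case: eqP => [da|]; last by rewrite !mul0r.
case: (dist e x0 (enum_val b) =P _) => [db|]; last by rewrite !mulr0.
case: eqP => [dab|]; last by rewrite mulr0 mul0r.
have h1 := dist_triangle conn (enum_val a) x0 (enum_val b).
have h2 := dist_triangle conn (enum_val b) x0 (enum_val a).
have h3 := dist_triangle conn x0 (enum_val a) (enum_val b).
rewrite (dist_sym conn esimple (enum_val b) (enum_val a)) in h2.
rewrite (dist_sym conn esimple (enum_val a) x0) in h3.
rewrite da db dab in h1 h2 h3.
by move: H; rewrite !ltnNge h1 h2 h3.
Qed.

(** A vertex of the sphere of radius n+2 and one of the sphere of radius 2 are at distance n, n+2 or
    n+4, by the triangle inequality and parity. *)
Lemma Estar_sum_dist_mx n :
  Es n.+2 *m (A n + A n.+2 + A n.+4) *m Es 2 = Es n.+2 *m const_mx 1 *m Es 2.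
Proof.
apply/matrixP => a b; rewrite !mul_EstarE !Estar_mulE !mxE.
case: eqP => [da|]; last by rewrite !mul0r.
case: (dist e x0 (enum_val b) =P _) => [db|]; last by rewrite !mulr0.
rewrite !(mul1r, mulr1).
have h1 := dist_triangle conn (enum_val b) x0 (enum_val a).
have h2 := dist_triangle conn x0 (enum_val a) (enum_val b).
have h3 := dist_parity conn bip (enum_val a) x0 (enum_val b).
rewrite (dist_sym conn esimple (enum_val b) (enum_val a)) in h1.
rewrite (dist_sym conn esimple (enum_val a) x0) in h2 h3.
move: h1 h2 h3; rewrite da db -!natrD; move: (dist e _ _) => m h1 h2 h3.
by congr _%:R; lia.
Qed.

End IntersectionNumbers.
(** * The numbers P_i(0) *)

Section PolynomialsAtZero.
Variables (C : numClosedFieldType) (p : nat -> nat -> nat -> nat) (D k : nat).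
Hypotheses (c0 : cnum p 0 = 0%N) (c1 : cnum p 1 = 1%N).
Hypothesis c_gt0 : forall i, (i < D)%N -> (0 < cnum p i.+1)%N.
Hypothesis b_gt0 : forall i, (i < D)%N -> (0 < bnum p i)%N.
Hypothesis bD : bnum p D = 0%N.
Hypothesis bck : forall i, (i <= D)%N -> (bnum p i + cnum p i)%N = k.

Local Notation c i := ((cnum p i)%:R : C).
Local Notation b i := ((bnum p i)%:R : C).
Local Notation q i := ((Ppoly C p i).[0]).

Lemma ppolyS i : ppoly C p i.+2 = ppoly C p i + fpoly C p i.+2.
Proof.
rewrite /ppoly; move: (fpoly C p) => f.
rewrite big_mkcond 2!big_ord_recr -big_mkcond /= negbK eqxx.
by congr (_ + _); case: odd; rewrite addr0.
Qed.

Lemma ppoly0 : ppoly C p 0 = 1.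
Proof. by rewrite /ppoly big_mkcond /= big_ord1. Qed.

Lemma ppoly1 : ppoly C p 1 = 'X.
Proof.
rewrite /ppoly big_mkcond /= !big_ord_recr big_ord0 /= !add0r.
by rewrite c1 invr1 scale1r.
Qed.

Lemma c_neq0 i : (i < D)%N -> c i.+1 != 0.
Proof. by move=> h; rewrite pnatr_eq0 -lt0n c_gt0. Qed.

Lemma b_neq0 i : (i < D)%N -> b i != 0.
Proof. by move=> h; rewrite pnatr_eq0 -lt0n b_gt0. Qed.

Lemma bcE i : (i <= D)%N -> b i = k%:R - c i.
Proof. by move=> h; rewrite -(bck h) natrD addrK. Qed.

(** Induction by steps of two, adding the recurrence of the f's to the previous case; the terms in
    p_{m+2} combine through b_{m+2} + c_{m+2} = k = b_{m+4} + c_{m+4}. *)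
Lemma ppoly_rec i : (i.+1 < D)%N ->
  'X * ppoly C p i.+1 = c i.+2 *: ppoly C p i.+2 + b i.+2 *: ppoly C p i.
Proof.
suff H n : ((n.+1 < D)%N -> 'X * ppoly C p n.+1 =
      c n.+2 *: ppoly C p n.+2 + b n.+2 *: ppoly C p n) /\
    ((n.+2 < D)%N -> 'X * ppoly C p n.+2 =
      c n.+3 *: ppoly C p n.+3 + b n.+3 *: ppoly C p n.+1).
  by move: (H i) => [].
have step m : (m.+3 < D)%N -> 'X * ppoly C p m.+1 =
      c m.+2 *: ppoly C p m.+2 + b m.+2 *: ppoly C p m ->
    'X * ppoly C p m.+3 =
      c m.+4 *: ppoly C p m.+4 + b m.+4 *: ppoly C p m.+2.
  move=> hm IH; rewrite (ppolyS m.+1) mulrDr IH fpoly_rec ?c_neq0 //.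
  rewrite (ppolyS m.+2) (ppolyS m) scalerDr.
  rewrite [b m.+4]bcE // [b m.+2]bcE; last by rewrite ltnW // ltnW.
  by rewrite -!mul_polyC !(rmorphB, rmorph_nat) /=; ring.
have base0 : (1 < D)%N -> 'X * ppoly C p 1 =
      c 2 *: ppoly C p 2 + b 2 *: ppoly C p 0.
  move=> D1; rewrite (ppolyS 0) ppoly1 ppoly0.
  rewrite {2}(_ : 'X = fpoly C p 1); last by rewrite /= c1 invr1 scale1r.
  rewrite fpoly_rec ?c_neq0 // scalerDr fpoly0.
  rewrite [b 0]bcE // [b 2]bcE // c0.
  by rewrite -!mul_polyC !(rmorphB, rmorph_nat) /=; ring.
elim: n => [|n [IH0 IH1]].
  split => // D2; rewrite (ppolyS 0) (ppolyS 1) mulrDr fpoly_rec ?c_neq0 //.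
  rewrite ppoly0 ppoly1 mulr1 /= c1 invr1 scale1r scalerDr.
  rewrite [b 1]bcE ?[b 3]bcE //; last by rewrite ltnW // ltnW.
  by rewrite c1 -!mul_polyC !(rmorphB, rmorph_nat) /=; ring.
split=> // h; apply: step => //; apply: IH0.
by apply: leq_trans h; rewrite !ltnS ltnW.
Qed.

(** This is the lowest coefficient of p_i allowed by parity; comparing it in [ppoly_rec] gives the
    two recurrences below. *)
Lemma Ppoly_at0 i : q i = (ppoly C p i)`_(odd i).
Proof.
by rewrite /Ppoly horner_coef0; case: odd;
  rewrite ?coef_odd_poly ?coef_even_poly.
Qed.

Lemma Ppoly0_at0 : q 0 = 1.
Proof. by rewrite Ppoly_at0 ppoly0 coef1. Qed.

Lemma Ppoly1_at0 : q 1 = 1.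
Proof. by rewrite Ppoly_at0 ppoly1 coefX. Qed.

Lemma Ppoly_at0_even i : ~~ odd i -> (i.+1 < D)%N ->
  c i.+2 * q i.+2 = - (b i.+2 * q i).
Proof.
move=> oi /ppoly_rec/(congr1 (fun f : {poly C} => f`_0)).
rewrite coefXM coefD !coefZ /= !Ppoly_at0 /= negbK (negPf oi) => /esym/eqP.
by rewrite addr_eq0 => /eqP.
Qed.

Lemma Ppoly_at0_odd i : odd i -> (i.+1 < D)%N ->
  c i.+2 * q i.+2 = q i.+1 - b i.+2 * q i.
Proof.
move=> oi /ppoly_rec/(congr1 (fun f : {poly C} => f`_1)).
rewrite coefXM coefD !coefZ /= !Ppoly_at0 /= negbK oi => ->.
by rewrite addrK.
Qed.

(** The recurrences preserve the sign pattern +, +, -, -, ...; in the odd one both terms on the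
    right have the same sign. *)
Lemma Ppoly_at0_sign m : (m.*2.+1 < D)%N ->
  0 < (-1) ^+ m * q m.*2 /\ 0 < (-1) ^+ m * q m.*2.+1.
Proof.
elim: m => [|m IH] hm.
  by rewrite Ppoly0_at0 Ppoly1_at0 mulr1 ltr01.
have hm' : (m.*2.+3 < D)%N by rewrite doubleS in hm.
have [IH0 IH1] : 0 < (-1) ^+ m * q m.*2 /\ 0 < (-1) ^+ m * q m.*2.+1.
  by apply: IH; apply: leq_trans hm'; rewrite !ltnS ltnW.
have h2 : (m.*2.+2 < D)%N by rewrite ltnW.
have h1 : (m.*2.+1 < D)%N by rewrite ltnW.
have E0 : 0 < (-1) ^+ m.+1 * q m.+1.*2.
  rewrite doubleS -(pmulr_rgt0 _ (_ : 0 < c m.*2.+2)) ?ltr0n ?c_gt0 //.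
  rewrite mulrCA Ppoly_at0_even ?odd_double // exprS -mulrA mulN1r mulrN opprK.
  by rewrite mulrCA mulr_gt0 // ltr0n b_gt0.
split => //.
rewrite doubleS -(pmulr_rgt0 _ (_ : 0 < c m.*2.+3)) ?ltr0n ?c_gt0 //.
rewrite mulrCA Ppoly_at0_odd /= ?odd_double // mulrBr addr_gt0 //.
by rewrite exprS -mulrA mulN1r opprK mulrCA mulr_gt0 // ltr0n b_gt0.
Qed.

Hypothesis D_even : ~~ odd D.

Lemma Ppoly_at0_neq0 i : (i < D)%N -> q i != 0.
Proof.
(* This odd number is at most D, and D is even. *)
move=> hi; have h : (i./2.*2.+1 < D)%N.
  rewrite ltn_neqAle; apply/andP; split.
    by apply: contraNneq D_even => <-; rewrite /= odd_double.
  by apply: leq_ltn_trans hi; rewrite -{2}(odd_double_half i) leq_addl.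
have [h0 h1] := Ppoly_at0_sign h.
apply/negP => /eqP q0; rewrite -(odd_double_half i) in q0.
by case: odd q0 => /= q0; move: h0 h1; rewrite ?add1n ?add0n in q0;
  rewrite q0 mulr0 ltxx.
Qed.

(** The even recurrence ends with c_D P_D(0) = -b_D P_{D-2}(0), and b_D = 0. *)
Lemma Ppoly_at0_diameter : (2 <= D)%N -> q D = 0.
Proof.
case: D c_gt0 bD D_even Ppoly_at0_even => [|[|n]] // cg b0 oD qe _.
apply: (mulfI (_ : c n.+2 != 0)); first by rewrite pnatr_eq0 -lt0n cg.
rewrite /= negbK in oD.
by rewrite qe // b0 mul0r oppr0 mulr0.
Qed.

(* The scalar with E*_i A_i v = alpha i *: E*_i A_{i-2} v for [2 <= i]. The
   junk value at [i = 1] only ever occurs multiplied by [c 0 = 0]. *)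
Definition alpha i : C :=
  - (b i * b i.+1 * q i.-2 / (c i.-1 * c i * q i)) - 1.

Lemma alpha2 : (4 <= D)%N -> alpha 2 = b 3 - 1.
Proof.
move=> D4; have D1 : (1 < D)%N by rewrite ltnW // ltnW.
rewrite /alpha /= c1 mul1r Ppoly_at0_even // Ppoly0_at0 !mulr1.
by field; rewrite b_neq0 // ltnW.
Qed.

(** The right side is the coefficient that arises when A lowers w_{n+1}. The recurrences at 0
    eliminate enough values P_i(0) to leave a rational identity. *)
Lemma omega_alpha n : (n.+3 <= D)%N ->
  omega C p n.+1 = b n + c n.+2 * alpha n.+2 - c n * alpha n.+1.
Proof.
move=> h2; have h1 : (n.+1 < D)%N by rewrite ltnW.
have h0 : (n < D)%N by rewrite ltnW.
have kE : b n = b n.+2 + c n.+2 - c n.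
  by rewrite !bcE ?(ltnW h0) ?(ltnW h2) //; ring.
have nc1 := c_neq0 h0; have nc2 := c_neq0 h1; have nc3 := c_neq0 h2.
have nb1 := b_neq0 h1; have nb2 := b_neq0 h2.
have nq1 := Ppoly_at0_neq0 h1; have nq2 := Ppoly_at0_neq0 h2.
have divE (x y z : C) : x != 0 -> x * y = z -> y = z / x.
  by move=> x0 <-; rewrite mulrC mulKf.
rewrite /omega /alpha kE.
(* For n = 0 the term with [alpha 1] is killed by c_0 = 0, and c_2 is eliminated through P_2(0). *)
case: n => [|n] /= in h2 h1 h0 kE nc1 nc2 nc3 nb1 nb2 nq1 nq2 *.
  have e2 := Ppoly_at0_even (isT : ~~ odd 0) h1.
  have e3 := divE _ _ _ nc3 (Ppoly_at0_odd (isT : odd 1) h2).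
  rewrite Ppoly0_at0 Ppoly1_at0 mulr1 in e2 e3 *.
  have {}e2 : c 2 = - b 2 / q 2 by rewrite -e2 mulfK.
  rewrite e3 c0 c1; move: nc2; rewrite e2 => nc2.
  rewrite mul0r !subr0.
  by field; rewrite nq2 nc3 nb2.
have nc0 : c n.+1 != 0 by rewrite c_neq0 // ltnW.
case: (boolP (odd n)) => on.
  have e1 : q n = (q n.+1 - c n.+2 * q n.+2) / b n.+2.
    by rewrite (Ppoly_at0_odd on h0); field.
  have e2 : q n.+1 = - (c n.+3 * q n.+3) / b n.+3.
    by rewrite (Ppoly_at0_even _ h1) /= ?negbK //; field.
  have e3 := divE _ _ _ nc3 (Ppoly_at0_odd (_ : odd n.+2) h2).
  rewrite e3 /= ?negbK // e1 e2; field.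
  by rewrite nc0 nq1 nq2 nb1 nb2 nc1 nc2 nc3.
have e1 : q n = - (c n.+2 * q n.+2) / b n.+2.
  by rewrite (Ppoly_at0_even on h0); field.
have e3 := divE _ _ _ nc3 (Ppoly_at0_even (_ : ~~ odd n.+2) h2).
rewrite e3 /= ?negbK // e1; field.
by rewrite nc0 nq1 nq2 nb1 nc1 nc2 nc3.
Qed.

(** Each 1 + alpha_i is a single quotient, so the identity is a cancellation. *)
Lemma alpha_rec n : (n.+3 < D)%N ->
  (1 + alpha n.+3) * omega C p n.+1 = b n.+4 * (1 + alpha n.+2).
Proof.
move=> h3; have h2 : (n.+2 < D)%N by rewrite ltnW.
have h1 : (n.+1 < D)%N by rewrite ltnW.
have h0 : (n < D)%N by rewrite ltnW.
rewrite /omega /alpha /=; field.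
by rewrite !(Ppoly_at0_neq0, c_neq0).
Qed.

(** The range stops at i = D-3, since omega_{D-2} contains the factor P_D(0) = 0. *)
Lemma omega_neq0 i : (0 < i)%N -> (i.+2 < D)%N -> omega C p i != 0.
Proof.
case: i => // i _ h; have h2 : (i.+2 < D)%N by rewrite ltnW.
have h1 : (i.+1 < D)%N by rewrite ltnW.
have h0 : (i < D)%N by rewrite ltnW.
by rewrite /omega /= !mulf_neq0 ?invr_neq0 ?mulf_neq0
  ?b_neq0 ?c_neq0 ?Ppoly_at0_neq0.
Qed.

End PolynomialsAtZero.

(** * The middle eigenvalue *)

Section Spectrum.
Variables (C : numClosedFieldType) (X : finType) (e : rel X).
Hypotheses (esimple : simple_graph e) (conn : connected_graph e).

(** Negating an eigenvector on one colour class negates its eigenvalue. *)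
Lemma eigenvalue_opp (a : C) : bipartite e ->
  eigenvalue (dist_mx C e 1) a -> eigenvalue (dist_mx C e 1) (- a).
Proof.
move=> [side hside] /eigenvalueP[v va v0]; pose s (i : 'I_#|X|) : C :=
  (-1) ^+ side (enum_val i).
apply/eigenvalueP; exists (\row_i (s i * v 0 i)).
  apply/rowP => j; move/rowP/(_ j): va; rewrite !mxE => vj.
  rewrite mulNr mulrCA -vj mulr_sumr -sumrN; apply: eq_bigr => i _.
  rewrite !mxE dist_eq1 // /s; case eij: (e _ _); last by rewrite !mulr0 oppr0.
  by have := hside _ _ eij; (do 2!case: (side _)); rewrite //= => _; ring.
apply: contraNneq v0 => /rowP s0; apply/eqP/rowP => i.
move: (s0 i); rewrite !mxE => /eqP.
by rewrite mulf_eq0 signr_eq0 => /eqP.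
Qed.

(** Negation reverses the strictly decreasing list of eigenvalues, so it fixes the middle one. *)
Lemma middle_eigenvalue (D : nat) (theta : nat -> C) : bipartite e ->
  ordered_eigenvalues e D theta -> ~~ odd D -> theta D./2 = 0.
Proof.
move=> bip [anti eigE] oD.
have opp i : (i <= D)%N -> exists2 j, (j <= D)%N & theta j = - theta i.
  by move=> iD; apply/eigE/eigenvalue_opp => //; apply/eigE; exists i.
have lt_index i j : (i <= D)%N -> (j <= D)%N -> theta j < theta i -> (i < j)%N.
  move=> iD jD tij; rewrite ltnNge leq_eqVlt; apply/negP => /orP[/eqP ji|ji].
    by rewrite ji ltxx in tij.
  by have := lt_trans tij (anti j i _); rewrite ji ltxx => /(_ iD).
have upper i j : (i <= D)%N -> (j <= D)%N -> theta j = - theta i ->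
    (i + j <= D)%N.
  elim: i j => [|i IH] j // iD jD tj.
  have [l lD tl] := opp i (ltnW iD).
  have jl : (j < l)%N by apply: lt_index; rewrite // tl tj ltrN2 anti ?ltnSn.
  by have := IH l (ltnW iD) lD tl; lia.
(* Here n stands for D - i, so this is an induction downwards from i = D. *)
have lower n i j : (i + n = D)%N -> (j <= D)%N -> theta j = - theta i ->
    (n <= j)%N.
  elim: n i j => [|n IH] i j // iD jD tj.
  have [|l lD tl] := opp i.+1; first lia.
  have jl : (l < j)%N.
    by apply: lt_index; rewrite // tl tj ltrN2 anti // ltnSn; lia.
  by have := IH i.+1 l _ lD tl; lia.
have [|j jD tj] := opp D./2; first lia.
have := upper _ _ _ jD tj; have := lower D./2 _ _ _ jD tj => lo up.
have jE : j = D./2 by lia.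
by move/esym/eqP: tj; rewrite jE eqNr => /eqP.
Qed.

End Spectrum.

(** * Modules of the Terwilliger algebra *)

Section Modules.
Variables (C : numClosedFieldType) (X : finType) (e : rel X) (x : X).
Local Notation A i := (dist_mx C e i).
Local Notation Es i := (Estar C e x i).
Implicit Types (W : {vspace 'cV[C]_#|X|}) (B : 'M[C]_#|X|).

Lemma mem_mxim B W w : w \in W -> B *m w \in mxim B W.
Proof. by move=> wW; rewrite -[B *m w](lfunE (mulmx B)) memv_img. Qed.

Lemma mximP B W w : reflect (exists2 u, u \in W & w = B *m u) (w \in mxim B W).
Proof.
apply: (iffP memv_imgP) => [[u uW ->]|[u uW ->]]; exists u => //.
  by rewrite lfunE.
by rewrite lfunE.
Qed.

Lemma thin_line W i u w : thin e x W -> u \in mxim (Es i) W ->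
  w \in mxim (Es i) W -> w != 0 -> exists a, u = a *: w.
Proof.
move=> /(_ i) dimW uW wW w0; apply/vlineP.
suff /eqP-> : <[w]>%VS == mxim (Es i) W by [].
by rewrite eqEdim -memvE wW dim_vline w0.
Qed.

Lemma mulmx_span B (s : seq 'cV[C]_#|X|) w :
  (forall u, u \in s -> B *m u \in <<s>>%VS) -> w \in <<s>>%VS ->
  B *m w \in <<s>>%VS.
Proof.
move=> Bs ws; apply: (subvP _ _ (mem_mxim B ws)).
rewrite /mxim limg_span; apply/span_subvP => _ /mapP[u us ->].
by rewrite lfunE /=; exact: Bs.
Qed.

(** Invariance need only be tested for the generators of T(x) on spanning vectors. *)
Lemma T_module_span (s : seq 'cV[C]_#|X|) :
  (forall u, u \in s -> A 1 *m u \in <<s>>%VS) ->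
  (forall i u, u \in s -> Es i *m u \in <<s>>%VS) ->
  T_module e x <<s>>%VS.
Proof.
move=> As Ess B.
elim=> {B} [|i||B1 B2 _ IH1 _ IH2|a B _ IH|B1 B2 _ IH1 _ IH2] w ws.
- exact: mulmx_span ws.
- by apply: mulmx_span ws; exact: Ess.
- by rewrite mul1mx.
- by rewrite mulmxDl rpredD // ?IH1 ?IH2.
- by rewrite -scalemxAl rpredZ // IH.
- by rewrite -mulmxA IH1 // IH2.
Qed.

Lemma Estar_gt_diameter i : (diameter e < i)%N -> Es i = 0.
Proof.
move=> hi; apply/matrixP => a b; rewrite !mxE ltn_eqF ?mul0rn //.
by apply: leq_ltn_trans hi; exact: dist_le_diameter.
Qed.

End Modules.

(** * The module W *)

Section EndpointTwo.
Variables (C : numClosedFieldType) (X : finType) (e : rel X).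
Variables (p : nat -> nat -> nat -> nat) (k : nat) (x : X).
Variables (W : {vspace 'cV[C]_#|X|}) (v : 'cV[C]_#|X|).
Hypotheses (esimple : simple_graph e) (conn : connected_graph e).
Hypotheses (bip : bipartite e) (dr : distance_regular e p).
Hypotheses (reg : regular e k).
Local Notation D := (diameter e).
Hypotheses (D_even : ~~ odd D) (D4 : (4 <= D)%N).
Hypotheses (irr : T_irreducible e x W) (thinW : thin e x W).
Hypothesis endW : has_endpoint e x W 2.
Hypothesis locW : has_local_eigenvalue e x W ((bnum p 3)%:R - 1).
Hypotheses (vW : v \in mxim (Estar C e x 2) W) (v0 : v != 0).

Local Notation A i := (dist_mx C e i).
Local Notation Es i := (Estar C e x i).
Local Notation c i := ((cnum p i)%:R : C).
Local Notation b i := ((bnum p i)%:R : C).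
Local Notation alpha := (alpha C p).
Local Notation omega := (omega C p).

Let c0 : cnum p 0 = 0%N := cnum0 esimple conn dr x.
Let c1 : cnum p 1 = 1%N := cnum1 conn dr x (ltnW (ltnW (ltnW D4))).
Let c_gt0 : forall i, (i < D)%N -> (0 < cnum p i.+1)%N :=
  cnum_gt0 esimple conn dr x.
Let b_gt0 : forall i, (i < D)%N -> (0 < bnum p i)%N :=
  bnum_gt0 esimple conn dr x.
Let bD : bnum p D = 0%N := bnum_diameter conn dr x.
Let bck : forall i, (i <= D)%N -> (bnum p i + cnum p i)%N = k :=
  fun i => bnum_cnum esimple conn bip dr x reg.

Let alpha_2 : alpha 2 = b 3 - 1 := alpha2 C c0 c1 c_gt0 b_gt0 bck D4.
Let omega_alphaE n : (n.+3 <= D)%N ->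
    omega n.+1 = b n + c n.+2 * alpha n.+2 - c n * alpha n.+1 :=
  @omega_alpha C p D k c0 c1 c_gt0 b_gt0 bck D_even n.
Let alpha_recE n : (n.+3 < D)%N ->
    (1 + alpha n.+3) * omega n.+1 = b n.+4 * (1 + alpha n.+2) :=
  @alpha_rec C p D k c0 c1 c_gt0 b_gt0 bck D_even n.
Let omega_n0 i : (0 < i)%N -> (i.+2 < D)%N -> omega i != 0 :=
  @omega_neq0 C p D k c0 c1 c_gt0 b_gt0 bck D_even i.

Lemma module_mem B u : in_T e x B -> u \in W -> B *m u \in W.
Proof. by have [TW _ _] := irr => /TW; apply. Qed.

Lemma Estar_v : Es 2 *m v = v.
Proof. by have /mximP[u _ ->] := vW; rewrite mulmxA Estar_idem. Qed.

Lemma v_in_W : v \in W.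
Proof.
by have /mximP[u uW ->] := vW; apply: module_mem => //; exact: in_T_Estar.
Qed.

Lemma Estar_W_eq0 i u : (i < 2)%N -> u \in W -> Es i *m u = 0.
Proof.
by have [_ h] := endW => /h W0 /(mem_mxim (Es i)); rewrite W0 memv0 => /eqP.
Qed.

(** The recurrence can be solved for A_{n+2} because c_{n+2} is nonzero up to the diameter. *)
Lemma in_T_dist_mx i : (i <= D)%N -> in_T e x (A i).
Proof.
suff H n : ((n <= D)%N -> in_T e x (A n)) /\ ((n < D)%N -> in_T e x (A n.+1)).
  by move: (H i) => [].
elim: n => [|n [IH0 IH1]].
  by split=> _; [rewrite dist_mx0 //; exact: in_T_one | exact: in_T_adj].
split=> // hn.
have -> : A n.+2 = (c n.+2)^-1 *: (A 1 *m A n.+1 + (- b n) *: A n).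
  rewrite (dist_mx_rec esimple conn bip dr) scaleNr addrAC subrr add0r.
  rewrite scalerA mulVf ?scale1r //.
  by rewrite pnatr_eq0 -lt0n c_gt0.
apply/in_T_scale/in_T_add.
  by apply: in_T_mul (in_T_adj _ _ _) (IH1 _); rewrite ltnW.
by apply: in_T_scale; apply: IH0; rewrite ltnW // ltnW.
Qed.

(** As v lives on the sphere of radius 2, the x-entry of A_2 v is the sum of all entries of v; it
    vanishes because E*_0 W = 0. *)
Lemma sum_v_eq0 : const_mx 1 *m v = 0 :> 'cV[C]_#|X|.
Proof.
have A2 : A 2 *m v \in W.
  by apply: module_mem v_in_W; apply: in_T_dist_mx; rewrite ltnW // ltnW.
have /matrixP/(_ (enum_rank x) 0) := Estar_W_eq0 (isT : (0 < 2)%N) A2.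
rewrite Estar_mulE enum_rankK.
have /eqP-> : dist e x x == 0%N by rewrite dist_eq0.
rewrite mul1r [RHS]mxE => sum0; apply/colP => a.
rewrite -Estar_v [RHS]mxE -[RHS]sum0 !mxE.
by apply: eq_bigr => j _; rewrite Estar_mulE !mxE enum_rankK mul1r.
Qed.

(** * Raising and lowering the projected vectors *)

Local Notation Z j n := (Es j *m (A n *m v)).
(** In the notation of the overview, u_n is [Z n n] and z_{n+4} is [Z n.+2 n.+4]. *)
Local Notation w n := (Z n.+2 n).

Lemma Z_eq0 j n : (j + n < 2)%N || (2 + n < j)%N || (j + 2 < n)%N -> Z j n = 0.
Proof.
by move=> H; rewrite -Estar_v !mulmxA Estar_dist_mx_eq0 ?mul0mx.
Qed.

Lemma Z_adj j n : Es j.+1 *m (A 1 *m (A n *m v)) =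
  Es j.+1 *m (A 1 *m Z j n) + Es j.+1 *m (A 1 *m Z j.+2 n).
Proof. by rewrite mulmxA (Estar_adj esimple) // mulmxDl !mulmxA. Qed.

Lemma Z_rec j n :
  Es j *m (A 1 *m (A n.+1 *m v)) = b n *: Z j n + c n.+2 *: Z j n.+2.
Proof.
by rewrite [A 1 *m _]mulmxA (dist_mx_rec esimple conn bip dr) mulmxDl mulmxDr
  -!scalemxAl -!scalemxAr.
Qed.

Lemma w0 : w 0 = v.
Proof. by rewrite dist_mx0 // mul1mx Estar_v. Qed.

(** A_n v is supported within distance n+2 of x, so only the outermost terms survive. *)
Lemma raise_w n : Es n.+3 *m (A 1 *m w n) = c n.+1 *: w n.+1.
Proof.
case: n => [|n]; first by rewrite w0 c1 scale1r.
have := Z_adj n.+3 n.+1; rewrite Z_rec.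
rewrite (@Z_eq0 n.+4 n) ?(@Z_eq0 n.+4.+1 n.+1); [ |lia|lia].
by rewrite scaler0 add0r !mulmx0 addr0 => <-.
Qed.

Lemma Z_sum n : w n + Z n.+2 n.+2 + Z n.+2 n.+4 = 0.
Proof.
rewrite -!mulmxDr -!mulmxDl -Estar_v !mulmxA Estar_sum_dist_mx //
   -!mulmxA Estar_v.
by rewrite sum_v_eq0 mulmx0.
Qed.

Lemma Z_in_mxim j n : (n <= D)%N -> Z j n \in mxim (Es j) W.
Proof.
by move=> nD; apply: mem_mxim; apply: module_mem v_in_W; exact: in_T_dist_mx.
Qed.

(** The projection of A A_{n+1} v to the sphere of radius n+2 receives contributions from u_{n+1}
    and w_{n+1}; subtracting the former leaves omega_{n+1}. *)
Lemma lower_w_step n : (n.+3 <= D)%N -> Z n.+2 n.+2 = alpha n.+2 *: w n ->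
  Es n.+2 *m (A 1 *m Z n.+1 n.+1) = (c n * alpha n.+1) *: w n ->
  Es n.+2 *m (A 1 *m w n.+1) = omega n.+1 *: w n.
Proof.
move=> nD uE rE; apply: (@addrI _ (Es n.+2 *m (A 1 *m Z n.+1 n.+1))).
rewrite -Z_adj Z_rec uE rE omega_alphaE // scalerA -!scalerDl.
by congr (_ *: _); ring.
Qed.

(** The three facts need a joint induction: together they give the lowering of w_{n+1}, which yields
    its nonvanishing and then the next scalar. *)
Lemma w_structure n : (n.+3 <= D)%N ->
  [/\ w n != 0, Z n.+2 n.+2 = alpha n.+2 *: w n &
      Es n.+2 *m (A 1 *m Z n.+1 n.+1) = (c n * alpha n.+1) *: w n].
Proof.
elim: n => [|n IH] hn.
  split; first by rewrite w0.
    rewrite w0 alpha_2 -locW // -!mulmxA Estar_v //.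
  (* Both sides vanish: c_0 = 0 on the right, and u_1 lies in E*_1 W = 0 on the left. *)
  rewrite c0 mul0r scale0r (@Estar_W_eq0 1) ?mulmx0 //.
  by rewrite module_mem ?v_in_W //; exact: in_T_adj.
have [wn uE rE] := IH (ltnW hn).
have lE := lower_w_step (ltnW hn) uE rE.
have om : omega n.+1 != 0 by apply: omega_n0.
have wn1 : w n.+1 != 0.
  apply: contraNneq (_ : omega n.+1 *: w n != 0) => [w1|].
    by rewrite -lE w1 !mulmx0.
  by rewrite scaler_eq0 negb_or om.
split=> //; last first.
  by rewrite uE -!scalemxAr raise_w scalerA mulrC.
have [a aE] : exists a, Z n.+3 n.+3 = a *: w n.+1.
  by apply: thin_line thinW _ _ wn1; apply: Z_in_mxim; lia.
rewrite aE; congr (_ *: _).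
have zE m d : Z m.+2 m.+2 = d *: w m -> Z m.+2 m.+4 = - (1 + d) *: w m.
  move=> dE; have := Z_sum m; rewrite dE => /eqP.
  rewrite addrC addr_eq0 => /eqP->.
  by rewrite scaleNr scalerDl scale1r.
(* Lowering z_{n+5} gives (1 + a) omega_{n+1} = b_{n+4} (1 + alpha_{n+2}), which determines a. For
   n+4 = D this is consistent with A_{D+1} = 0 because b_D = 0. *)
have := Z_adj n.+1 n.+4.+1; rewrite Z_rec.
rewrite (@Z_eq0 n.+2 n.+4.+2) ?(@Z_eq0 n.+1 n.+4.+1); [ |lia|lia].
rewrite (zE _ _ aE) (zE _ _ uE) mulmx0 mulmx0 add0r scaler0 addr0.
rewrite -!scalemxAr lE !scalerA => /eqP.
rewrite -subr_eq0 -scalerBl scaler_eq0 (negPf wn) orbF subr_eq0 => /eqP.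
rewrite mulNr mulrN => /oppr_inj; rewrite -alpha_recE // => /(mulIf om)/addrI.
by move->.
Qed.

Lemma lower_w n : (n.+3 <= D)%N ->
  Es n.+2 *m (A 1 *m w n.+1) = omega n.+1 *: w n.
Proof.
by move=> nD; have [_ uE rE] := w_structure nD; exact: lower_w_step.
Qed.

(** * Action of A on the vectors w_n and the basis of W *)

Lemma Estar_w i n : Es i *m w n = (i == n.+2)%:R *: w n.
Proof.
rewrite mulmxA; case: eqP => [->|/eqP ni]; first by rewrite Estar_idem scale1r.
by rewrite Estar_orth // mul0mx scale0r.
Qed.

Lemma adj_w n : A 1 *m w n.+1 = Es n.+2 *m (A 1 *m w n.+1) + c n.+2 *: w n.+2.
Proof.
rewrite -raise_w {1}mulmxA (adj_Estar esimple conn bip) mulmxDl.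
by rewrite -!mulmxA.
Qed.

Lemma adj_w0 : A 1 *m w 0 = c 1 *: w 1.
Proof.
rewrite -raise_w {1}mulmxA (adj_Estar esimple conn bip) mulmxDl -!mulmxA.
rewrite (@Estar_W_eq0 1) ?add0r // w0 module_mem ?v_in_W //; exact: in_T_adj.
Qed.

(** Were it nonzero, its span would be a proper nonzero submodule, contradicting irreducibility. *)
Lemma w_last : w (D - 2) = 0.
Proof.
case DE: (D - 2)%N => [|m]; first by lia.
have {}DE : D = m.+3 by lia.
apply/eqP/negPn/negP => wm0.
(* The lowering coefficient omega_{D-2} contains P_D(0) = 0, and raising leads to the empty sphere
   of radius D+1. *)
have Aw : A 1 *m w m.+1 = 0.
  rewrite adj_w lower_w ?DE // [Es m.+4]Estar_gt_diameter ?DE // mul0mx scaler0.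
  rewrite /Defs.omega /= -DE.
  by rewrite (Ppoly_at0_diameter C c0 c1 c_gt0 bD bck D_even)
    ?(mulr0, mul0r, scale0r, addr0) //; lia.
have TU : T_module e x <<[:: w m.+1]>>%VS.
  apply: T_module_span => [u|i u]; rewrite inE => /eqP->.
    by rewrite Aw mem0v.
  by rewrite Estar_w rpredZ // memv_span // inE.
have [_ _ /(_ _ TU)] := irr; rewrite span_seq1 -memvE => [[]].
- apply: module_mem; first exact: in_T_Estar.
  by apply: module_mem v_in_W; apply: in_T_dist_mx; lia.
- by move/eqP; rewrite -subv0 -memvE memv0 (negPf wm0).
(* If the line were W, then v would be a multiple of w_{D-2}, which E*_2 kills although it fixes
   v. *)
move=> UW; have := v_in_W; rewrite -UW => /vlineP[a va].
by move: v0; rewrite -Estar_v va -scalemxAr Estar_w scale0r scaler0 eqxx.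
Qed.

(** The vectors are nonzero and lie on distinct spheres, so E*_{i+2} isolates the i-th
    coefficient. *)
Lemma w_free : free [tuple w i | i < D - 2].
Proof.
apply/freeP => a + i; under eq_bigr do rewrite -tnth_nth tnth_mktuple.
move=> /(congr1 (mulmx (Es i.+2))) sum0; apply/eqP; move: sum0.
have iD : (i.+3 <= D)%N by have := ltn_ord i; lia.
have [wi0 _ _] := w_structure iD.
rewrite mulmx0 mulmx_sumr (bigD1 i) //= big1 => [|j ji]; last first.
  rewrite -val_eqE eq_sym /= in ji.
  by rewrite -scalemxAr Estar_w !eqSS (negPf ji) scale0r scaler0.
rewrite addr0 -scalemxAr Estar_w eqxx scale1r => /eqP.
by rewrite scaler_eq0 (negPf wi0) orbF.
Qed.

Lemma tridiag_sum (f : nat -> 'cV[C]_#|X|) (m : nat) (j : 'I_m) :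
  \sum_(i < m) tridiag C p m i j *: f i =
  (if (j.+1 < m)%N then c j.+1 *: f j.+1 else 0) +
  (if (0 < j)%N then omega j *: f j.-1 else 0).
Proof.
have -> : \sum_(i < m) tridiag C p m i j *: f i =
    \sum_(i < m | i == j.+1 :> nat) c i *: f i +
    \sum_(i < m | i.+1 == j :> nat) omega j *: f i.
  rewrite [X in _ = X + _]big_mkcond [X in _ = _ + X]big_mkcond -big_split /=.
  apply: eq_bigr => i _.
  rewrite mxE eq_sym [j == _ :> nat]eq_sym.
  case: eqP => [<-|_]; first by rewrite gtn_eqF ?addr0.
  by rewrite add0r; case: ifP => // _; rewrite scale0r.
rewrite (big_ord1_eq _ (fun i => c i *: f i)); congr (_ + _).
case: j => [[|j] jm] /=; first by rewrite big1.
rewrite (big_ord1_eq _ (fun i => omega j.+1 *: f i)).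
by rewrite ltnW.
Qed.

Lemma w_represents :
  represents [tuple w i | i < D - 2] (A 1) (tridiag C p (D - 2)).
Proof.
move=> j; rewrite tnth_mktuple.
under eq_bigr do rewrite tnth_mktuple.
rewrite (tridiag_sum (fun i => w i)).
(* The last column has no subdiagonal entry; the term it would carry vanishes by [w_last]. *)
have next : (if (j.+1 < D - 2)%N then c j.+1 *: w j.+1 else 0)
    = c j.+1 *: w j.+1.
  case: ltnP => // jm; have -> : j.+1 = (D - 2)%N by have := ltn_ord j; lia.
  by rewrite w_last scaler0.
rewrite next; case: j => [[|j] jm] /= in next *; first by rewrite adj_w0 addr0.
by rewrite adj_w lower_w 1?addrC //; lia.
Qed.

(** The span is a submodule of W containing w_0 = v, so irreducibility makes it all of W. *)
Lemma w_basis : basis_of W [tuple w i | i < D - 2].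
Proof.
apply/andP; split; last exact: w_free.
set s := [tuple _ | _ < _].
have sP u : u \in s -> exists i : 'I_(D - 2), u = w i.
  by case/tnthP=> i ->; exists i; rewrite tnth_mktuple.
have ws (i : 'I_(D - 2)) : w i \in <<s>>%VS.
  by apply: memv_span; apply/tnthP; exists i; rewrite tnth_mktuple.
have TU : T_module e x <<s>>%VS.
  apply: T_module_span => [u|i u] /tnthP[j ->].
    by rewrite w_represents memv_suml // => i _;
      rewrite rpredZ // memv_span // mem_tnth.
  by rewrite tnth_mktuple Estar_w rpredZ.
have [_ _ /(_ _ TU)] := irr; case; last by move=> ->.
  apply/span_subvP => u /sP[i ->]; apply: module_mem; first exact: in_T_Estar.
  by apply: module_mem v_in_W; apply: in_T_dist_mx; have := ltn_ord i; lia.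
have D2 : (0 < D - 2)%N by lia.
have := ws (Ordinal D2); rewrite /= w0 => vs U0; move: vs.
by rewrite U0 memv0 (negPf v0).
Qed.

End EndpointTwo.

Theorem theorem14p6 (C : numClosedFieldType) (X : finType) (e : rel X)
  (p : nat -> nat -> nat -> nat) (D k : nat) (theta : nat -> C)
  (x : X) (W : {vspace 'cV[C]_#|X|}) (v : 'cV[C]_#|X|)
  (hsimple : simple_graph e) (hconn : connected_graph e)
  (hbip : bipartite e) (hdr : distance_regular e p)
  (hdiam : diameter e = D) (hDeven : ~~ odd D) (hD : (4 <= D)%N)
  (hval : regular e k) (hk : (3 <= k)%N)
  (htheta : ordered_eigenvalues e D theta)
  (hirr : T_irreducible e x W) (hthin : thin e x W)
  (hend : has_endpoint e x W 2)
  (hloc : has_local_eigenvalue e x W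
            (- 1 - (bnum p 2)%:R * (bnum p 3)%:R
                   * (theta D./2 ^+ 2 - (bnum p 2)%:R)^-1))
  (hvW : v \in mxim (Estar C e x 2) W) (hv : v != 0) :
  let w := [tuple Estar C e x i.+2 *m dist_mx C e i *m v | i < D - 2] in
  basis_of W w /\
  represents w (dist_mx C e 1) (tridiag C p (D - 2)).
Proof.
subst D; have b2 : (bnum p 2)%:R != 0 :> C.
  by rewrite pnatr_eq0 -lt0n (bnum_gt0 hsimple hconn hdr x) //; lia.
(* With theta_{D/2} = 0 the fraction reduces to b_3, after division by the nonzero b_2. *)
have local_eq : - 1 - (bnum p 2)%:R * (bnum p 3)%:R
    * (theta (diameter e)./2 ^+ 2 - (bnum p 2)%:R)^-1 = (bnum p 3)%:R - 1 :> C.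
  by rewrite (middle_eigenvalue hsimple hconn hbip htheta hDeven); field.
rewrite local_eq in hloc => w.
have -> : w =
    [tuple Estar C e x i.+2 *m (dist_mx C e i *m v) | i < diameter e - 2].
  by apply: eq_from_tnth => i; rewrite !tnth_mktuple mulmxA.
split.
  exact: (w_basis hsimple hconn hbip hdr hval hDeven hD hirr hthin hend
  hloc hvW hv).
exact: (w_represents hsimple hconn hbip hdr hval hDeven hD hirr hthin hend
  hloc hvW hv).
Qed.
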